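(* Let $Q$ be a subdirectly irreducible medial quandle of quasi-affine type. Then $Q$ is latin.
   Context: A quandle is an algebra $(Q,\ast,\backslash)$ with two binary operations such that for all $x,y,z\in Q$: $x\ast x=x$; $x\ast(y\ast z)=(x\ast y)\ast(x\ast z)$; $x\backslash(x\ast y)=y=x\ast(x\backslash y)$. It is medial if for all $x,y,u,v$: $(x\ast y)\ast(u\ast v)=(x\ast u)\ast(y\ast v)$, $(x\backslash y)\backslash(u\backslash v)=(x\backslash u)\backslash(y\backslash v)$ and $(x\backslash y)\ast(u\backslash v)=(x\ast u)\backslash(y\ast v)$. A quandle is latin if every right translation $R_e\colon x\mapsto x\ast e$ is a bijection. An algebra is subdirectly irreducible if the intersection of all its non-trivial congruences (congruences different from equality) is a non-trivial congruence; this least non-trivial congruence is called the monolith. By idempotency, each block of the monolith of a quandle is a subquandle. A subdirectly irreducible medial quandle is of quasi-affine type if, for each block of the monolith (regarded as a subalgebra), the clone of its term operations either contains a cancellative binary operation (cancellative in both arguments) or is generated by the operation $x+y+z \bmod 2$. *)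

(* Defs.v *)
From HB Require Import structures.
From mathcomp Require Import all_boot.
From mathcomp Require Import boolp.

Set Implicit Arguments.
Unset Strict Implicit.
Unset Printing Implicit Defensive.

(* [interchange f g] reads [f (g x y) (g u v) = g (f x u) (f y v)];
   [right_distributive f f] reads [f x (f y z) = f (f x y) (f x z)]. *)

HB.mixin Record isQuandle (Q : Type) := {
  qmul : Q -> Q -> Q;
  qldiv : Q -> Q -> Q;
  qmulxx : forall x, qmul x x = x;
  qmulDr : right_distributive qmul qmul;
  qmulK : forall x, cancel (qmul x) (qldiv x);
  qldivK : forall x, cancel (qldiv x) (qmul x)
}.

#[short(type="quandleType")]
HB.structure Definition Quandle := {Q of isQuandle Q}.

Definition medial (Q : quandleType) : Prop :=
  [/\ interchange (@qmul Q) (@qmul Q),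
      interchange (@qldiv Q) (@qldiv Q) &
      interchange (@qmul Q) (@qldiv Q)].

Definition latin (Q : quandleType) : Prop :=
  forall e : Q, bijective (fun x : Q => qmul x e).

Record congruence (Q : quandleType) (theta : Q -> Q -> Prop) : Prop :=
  Congruence {
    cong_refl : forall x, theta x x;
    cong_sym : forall x y, theta x y -> theta y x;
    cong_trans : forall x y z, theta x y -> theta y z -> theta x z;
    cong_mul : forall x x' y y',
      theta x x' -> theta y y' -> theta (qmul x y) (qmul x' y');
    cong_ldiv : forall x x' y y',
      theta x x' -> theta y y' -> theta (qldiv x y) (qldiv x' y')
  }.

Definition nontrivial_congruence (Q : quandleType) (theta : Q -> Q -> Prop) :=
  congruence theta /\ ~ (forall x y, theta x y <-> x = y).

(* If [Q] has at most one element, it has no non-trivial congruence and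
   this is the full relation, which is then equality. *)
Definition monolith (Q : quandleType) (x y : Q) : Prop :=
  forall theta : Q -> Q -> Prop, nontrivial_congruence theta -> theta x y.

Definition subdirectly_irreducible (Q : quandleType) : Prop :=
  nontrivial_congruence (@monolith Q).

Lemma monolith_congruence (Q : quandleType) : congruence (@monolith Q).
Proof.
split.
- by move=> x theta [ct _]; apply: cong_refl.
- by move=> x y xy theta nt; apply: (cong_sym nt.1); apply: xy.
- move=> x y z xy yz theta nt.
  exact: (cong_trans nt.1 (xy _ nt) (yz _ nt)).
- by move=> x x' y y' xx yy theta nt; apply: (cong_mul nt.1); [apply: xx | apply: yy].
- by move=> x x' y y' xx yy theta nt; apply: (cong_ldiv nt.1); [apply: xx | apply: yy].
Qed.

Lemma qldivxx (Q : quandleType) (x : Q) : qldiv x x = x.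
Proof. by rewrite -{2}(qmulxx x) qmulK. Qed.

Definition block (Q : quandleType) (theta : Q -> Q -> Prop)
  (ct : congruence theta) (e : Q) : Type := {x : Q | theta e x}.

Lemma block_mul_subproof (Q : quandleType) (theta : Q -> Q -> Prop)
  (ct : congruence theta) (e : Q) (x y : block ct e) :
  theta e (qmul (sval x) (sval y)).
Proof.
case: x y => [x ex] [y ey] /=.
by rewrite -(qmulxx e); apply: (cong_mul ct).
Qed.

Lemma block_ldiv_subproof (Q : quandleType) (theta : Q -> Q -> Prop)
  (ct : congruence theta) (e : Q) (x y : block ct e) :
  theta e (qldiv (sval x) (sval y)).
Proof.
case: x y => [x ex] [y ey] /=.
by rewrite -(qldivxx e); apply: (cong_ldiv ct).
Qed.

Definition block_mul (Q : quandleType) (theta : Q -> Q -> Prop)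
  (ct : congruence theta) (e : Q) (x y : block ct e) : block ct e :=
  exist _ (qmul (sval x) (sval y)) (block_mul_subproof x y).

Definition block_ldiv (Q : quandleType) (theta : Q -> Q -> Prop)
  (ct : congruence theta) (e : Q) (x y : block ct e) : block ct e :=
  exist _ (qldiv (sval x) (sval y)) (block_ldiv_subproof x y).

Lemma block_inj (Q : quandleType) (theta : Q -> Q -> Prop)
  (ct : congruence theta) (e : Q) (x y : block ct e) :
  sval x = sval y -> x = y.
Proof.
case: x y => [x px] [y py] /= xy; subst y.
by rewrite (Prop_irrelevance px py).
Qed.

Lemma block_mulxx (Q : quandleType) (theta : Q -> Q -> Prop)
  (ct : congruence theta) (e : Q) (x : block ct e) : block_mul x x = x.
Proof. by apply: block_inj; apply: qmulxx. Qed.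

Lemma block_mulDr (Q : quandleType) (theta : Q -> Q -> Prop)
  (ct : congruence theta) (e : Q) :
  right_distributive (@block_mul Q theta ct e) (@block_mul Q theta ct e).
Proof. by move=> x y z; apply: block_inj; apply: qmulDr. Qed.

Lemma block_mulK (Q : quandleType) (theta : Q -> Q -> Prop)
  (ct : congruence theta) (e : Q) (x : block ct e) :
  cancel (block_mul x) (block_ldiv x).
Proof. by move=> y; apply: block_inj; apply: qmulK. Qed.

Lemma block_ldivK (Q : quandleType) (theta : Q -> Q -> Prop)
  (ct : congruence theta) (e : Q) (x : block ct e) :
  cancel (block_ldiv x) (block_mul x).
Proof. by move=> y; apply: block_inj; apply: qldivK. Qed.

HB.instance Definition _ (Q : quandleType) (theta : Q -> Q -> Prop)
    (ct : congruence theta) (e : Q) :=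
  isQuandle.Build (block ct e) (@block_mulxx Q theta ct e)
    (@block_mulDr Q theta ct e) (@block_mulK Q theta ct e)
    (@block_ldivK Q theta ct e).

Definition op2 (A : Type) (b : A -> A -> A) : 2.-tuple A -> A :=
  fun a => b (tnth a (Ordinal (isT : 0 < 2))) (tnth a (Ordinal (isT : 1 < 2))).

Definition op3 (A : Type) (t : A -> A -> A -> A) : 3.-tuple A -> A :=
  fun a => t (tnth a (Ordinal (isT : 0 < 3))) (tnth a (Ordinal (isT : 1 < 3)))
             (tnth a (Ordinal (isT : 2 < 3))).

Inductive clone (A : Type) (F : forall n, (n.-tuple A -> A) -> Prop) :
  forall n, (n.-tuple A -> A) -> Prop :=
| clone_gen n (f : n.-tuple A -> A) : F n f -> clone F f
| clone_proj n (i : 'I_n) : clone F (fun a : n.-tuple A => tnth a i)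
| clone_comp m n (f : n.-tuple A -> A) (g : 'I_n -> m.-tuple A -> A) :
    clone F f -> (forall i, clone F (g i)) ->
    clone F (fun a : m.-tuple A => f [tuple g i a | i < n]).

Inductive quandle_basic_op (Q : quandleType) :
  forall n, (n.-tuple Q -> Q) -> Prop :=
| basic_mul : quandle_basic_op (op2 (@qmul Q))
| basic_ldiv : quandle_basic_op (op2 (@qldiv Q)).

Definition term_operation (Q : quandleType) (n : nat) (f : n.-tuple Q -> Q) :
  Prop := clone (@quandle_basic_op Q) f.

Definition has_cancellative_binary_term (Q : quandleType) : Prop :=
  exists b : Q -> Q -> Q,
    [/\ term_operation (op2 b), right_injective b & left_injective b].

Inductive single_op3 (A : Type) (t : A -> A -> A -> A) :
  forall n, (n.-tuple A -> A) -> Prop :=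
| single_op3_intro : single_op3 t (op3 t).

(* [add] and [zero] make the carrier an elementary abelian 2-group, that is,
   a vector space over the integers modulo 2, of arbitrary dimension. *)
Definition generated_by_sum3_mod2 (Q : quandleType) : Prop :=
  exists (add : Q -> Q -> Q) (zero : Q),
    [/\ associative add, commutative add, left_id zero add,
        self_inverse zero add &
        forall n (f : n.-tuple Q -> Q),
          term_operation f <->
          clone (single_op3 (fun x y z => add (add x y) z)) f].

Definition quasi_affine_type (Q : quandleType) : Prop :=
  forall e : Q,
    has_cancellative_binary_term (block (monolith_congruence Q) e) \/
    generated_by_sum3_mod2 (block (monolith_congruence Q) e).

(* Main.v *)
(* If a right translation R_e is not injective, its kernel, a congruence by
   mediality, contains the monolith mu. If e lies in a nontrivial mu-block B,
   then e is fixed by all left translations of B, so no binary term is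
   cancellative on B; and the operations of B are not generated by x + y + z
   either, since that would make B a projection algebra. Mediality reduces the
   remaining elements e to this case, so all right translations are injective.

   The displacement group D, generated by the L_x L_y^-1, is then abelian and
   acts semiregularly, and conjugation by L_e is an automorphism t of D
   independent of e. Orbits of t-stable subgroups are congruences, so subdirect
   irreducibility yields s <> 0 lying in every nonzero Z[t, t^-1]-submodule of D.
   Surjectivity of R_e amounts to surjectivity of 1 - t on D, because
   (n - t n) e = (n e) * e; the latter follows from noetherianity of Z[X]. *)
Require Import Defs.
From HB Require Import structures.
From mathcomp Require Import all_boot all_order all_algebra.
From mathcomp Require Import boolp.

Set Implicit Arguments.
Unset Strict Implicit.
Unset Printing Implicit Defensive.

Import Order.TTheory GRing.Theory Num.Theory.
Local Open Scope ring_scope.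

(** * Noetherianity of Z[X] *)

Record is_ideal (R : comNzRingType) (J : R -> Prop) : Prop := IsIdeal {
  ideal0 : J 0;
  idealD : forall x y, J x -> J y -> J (x + y);
  idealMl : forall r x, J x -> J (r * x)
}.

Lemma idealB (R : comNzRingType) (J : R -> Prop) (x y : R) :
  is_ideal J -> J x -> J y -> J (x - y).
Proof.
by move=> iJ Jx Jy; rewrite -mulN1r; apply: (idealD iJ) => //; apply: idealMl.
Qed.

Definition ascending (T : Type) (J : nat -> T -> Prop) :=
  forall k x, J k x -> J k.+1 x.

Lemma ascending_le (T : Type) (J : nat -> T -> Prop) (k l : nat) (x : T) :
  ascending J -> (k <= l)%N -> J k x -> J l x.
Proof.
move=> aJ /subnK <- Jx; elim: (l - k)%N => [//|m IHm].
exact: aJ.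
Qed.

Definition noetherian (R : comNzRingType) :=
  forall J : nat -> R -> Prop, (forall k, is_ideal (J k)) -> ascending J ->
  exists N, forall k x, J k x -> J N x.

(** The union of the chain is generated by its least positive element, if any, and that element
    already lies in some [J N]. *)
Lemma int_noetherian : noetherian int.
Proof.
move=> J iJ aJ.
pose P n := `[< exists k, J k n.+1%:Z >].
have [exP|nexP] := pselect (exists n, P n); last first.
  exists 0%N => k x Jx; have [->|x0] := eqVneq x 0; first exact: ideal0.
  case: nexP; exists (`|x|.-1)%N; apply/asboolP; exists k.
  rewrite prednK ?absz_gt0//.
  by rewrite abszE normrEsg; apply: idealMl.
case: (ex_minnP exP) => n /asboolP[N Jn] n_min; exists N => k x Jx.
have Jmod : J (maxn k N) (x %% n.+1%:Z)%Z.
  rewrite /modz; apply: idealB => //.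
    exact: ascending_le (leq_maxl _ _) Jx.
  by apply: idealMl => //; apply: ascending_le (leq_maxr _ _) Jn.
suff m0 : (x %% n.+1%:Z)%Z = 0.
  by rewrite (divz_eq x n.+1%:Z) m0 addr0; apply: idealMl.
have := ltz_pmod x (isT : 0 < n.+1%:Z).
have := modz_ge0 x (isT : n.+1%:Z != 0).
case: (_ %% _)%Z Jmod => [[|m]|]// Jm _ mn.
have /n_min : P m by apply/asboolP; exists (maxn k N).
by rewrite leqNgt; move: mn; rewrite ltz_nat ltnS => ->.
Qed.

(** The size is bounded rather than fixed, so that [c] may be 0 and the set is an ideal. *)
Definition lead_ideal (R : comNzRingType) (J : {poly R} -> Prop) (d : nat)
  (c : R) : Prop := exists p, [/\ J p, (size p <= d.+1)%N & p`_d = c].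

Lemma lead_ideal_ideal (R : comNzRingType) (J : {poly R} -> Prop) (d : nat) :
  is_ideal J -> is_ideal (lead_ideal J d).
Proof.
move=> iJ; split.
- by exists 0; rewrite size_poly0 coef0; split=> //; apply: ideal0.
- move=> _ _ [p [Jp sp <-]] [q [Jq sq <-]]; exists (p + q); split.
  + exact: idealD.
  + by rewrite (leq_trans (size_polyD _ _))// geq_max sp.
  + by rewrite coefD.
- move=> r _ [p [Jp sp <-]]; exists (r *: p); split.
  + by rewrite -mul_polyC; apply: idealMl.
  + exact: leq_trans (size_scale_leq _ _) sp.
  + by rewrite coefZ.
Qed.

Lemma lead_ideal_ascending (R : comNzRingType) (J : {poly R} -> Prop) :
  is_ideal J -> ascending (lead_ideal J).
Proof.
move=> iJ d _ [p [Jp sp <-]]; exists ('X * p); split.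
- exact: idealMl.
- by rewrite (leq_trans (size_polyMleq _ _))// size_polyX.
- by rewrite coefXM.
Qed.

(* Stabilising the diagonal [lead_ideal (J k) k] first controls all degrees
   beyond some [N] at once; only finitely many degrees are left. *)
Lemma poly_noetherian (R : comNzRingType) :
  noetherian R -> noetherian {poly R}.
Proof.
move=> noethR J iJ aJ.
have LI k d : is_ideal (lead_ideal (J k) d) by exact: lead_ideal_ideal.
have Ld k : ascending (lead_ideal (J k)) by exact: lead_ideal_ascending.
have Lk d : ascending (fun k => lead_ideal (J k) d).
  by move=> k c [p [Jp sp pc]]; exists p; split=> //; apply: aJ.
have [|N HN] := noethR (fun k => lead_ideal (J k) k) (fun k => LI k k).
  by move=> k c /Lk; apply: Ld.
have [M HM] : exists M, forall d k c, (d < N)%N ->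
    lead_ideal (J k) d c -> lead_ideal (J M) d c.
  elim: N {HN} => [|N [M HM]]; first by exists 0%N.
  have [K HK] := noethR _ (LI^~ N) (Lk N).
  exists (maxn M K) => d k c; rewrite ltnS leq_eqVlt => /predU1P[->|dN] Lc.
    exact: (ascending_le (Lk N) (leq_maxr M K)) (HK _ _ Lc).
  exact: (ascending_le (Lk d) (leq_maxl M K)) (HM _ _ _ dN Lc).
pose K := maxn M N.
have HK d k c : lead_ideal (J k) d c -> lead_ideal (J K) d c.
  have [dN|Nd] := ltnP d N => Lc.
    exact: (ascending_le (Lk d) (leq_maxl M N)) (HM _ _ _ dN Lc).
  apply: (ascending_le (Lk d) (leq_maxr M N)).
  (* Both indices are raised to [maxn k d], which lands on the diagonal. *)
  apply: (ascending_le (Ld N) Nd); apply: (HN (maxn k d)).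
  apply: (ascending_le (Lk _) (leq_maxl k d)).
  exact: (ascending_le (Ld k) (leq_maxr k d)).
exists K => k p Jp.
have [n] := ubnP (size p); elim: n => // n IHn in k p Jp *; rewrite ltnS => sp.
have [->|p0] := eqVneq p 0; first exact: ideal0.
have [|g [Jg sg gp]] := HK (size p).-1 k p`_(size p).-1.
  by exists p; rewrite prednK ?size_poly_gt0.
(* [g] cancels the leading term of [p], so [p - g] has smaller size. *)
rewrite -(subrK g p); apply: (idealD (iJ K)) => //.
apply: (IHn (maxn k K)).
  apply: idealB => //.
    exact: (ascending_le aJ (leq_maxl k K)).
  exact: (ascending_le aJ (leq_maxr k K)).
apply: leq_trans sp; rewrite -[X in (_ < X)%N]prednK ?size_poly_gt0// ltnS.
apply/leq_sizeP => j; rewrite leq_eqVlt coefB => /predU1P[<-|sj].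
  by rewrite gp subrr.
rewrite !nth_default ?subrr//; first by rewrite (leq_trans sg).
by rewrite -[size p]prednK ?size_poly_gt0.
Qed.

(** * Abelian groups with an automorphism *)

(** Makes [A] a Z[X]-module on which X acts as [t]. *)
Definition poly_act (A : zmodType) (t : {additive A -> A}) (f : {poly int})
  (a : A) : A := \sum_(i < size f) iter i t a *~ f`_i.

Section PolyAct.
Variables (A : zmodType) (t : {additive A -> A}).
Implicit Types (f g : {poly int}) (a b : A) (c : int).

Lemma poly_act_widen f a n : (size f <= n)%N ->
  poly_act t f a = \sum_(i < n) iter i t a *~ f`_i.
Proof.
move=> fn; rewrite /poly_act (big_ord_widen n (fun i => iter i t a *~ f`_i))//.
by rewrite big_mkcond; apply: eq_bigr => i _; case: ltnP => // ?;
  rewrite nth_default// mulr0z.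
Qed.

Lemma poly_actDl f g a : poly_act t (f + g) a = poly_act t f a + poly_act t g a.
Proof.
rewrite !(@poly_act_widen _ _ (maxn (size f) (size g))) ?leq_maxl ?leq_maxr//.
  by rewrite -big_split; apply: eq_bigr => i _; rewrite coefD mulrzDr.
exact: size_polyD.
Qed.

Lemma poly_actZ c f a : poly_act t (c *: f) a = poly_act t f a *~ c.
Proof.
rewrite (poly_act_widen _ (size_scale_leq c f)) /poly_act mulrz_suml.
by apply: eq_bigr => i _; rewrite coefZ mulrC mulrzA.
Qed.

Lemma poly_act0 a : poly_act t 0 a = 0.
Proof. by rewrite -(scale0r 0) poly_actZ mulr0z. Qed.

Lemma poly_actXM f a : poly_act t ('X * f) a = t (poly_act t f a).
Proof.
rewrite (@poly_act_widen _ _ (size f).+1); last first.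
  by rewrite (leq_trans (size_polyMleq _ _))// size_polyX.
rewrite big_ord_recl coefXM mulr0z add0r raddf_sum; apply: eq_bigr => i _.
by rewrite coefXM /= raddfMz.
Qed.

Lemma poly_act1 a : poly_act t 1 a = a.
Proof. by rewrite /poly_act size_poly1 big_ord1 coef1 mulr1z. Qed.

Lemma poly_actM f g a : poly_act t (f * g) a = poly_act t f (poly_act t g a).
Proof.
elim/poly_ind: f a => [|f c IHf] a.
  by rewrite mul0r !poly_act0.
rewrite mulrDl !poly_actDl -mulrA mulrCA mul_polyC (mulrC f 'X) !poly_actXM -IHf.
by rewrite -[c%:P]alg_polyC !poly_actZ poly_act1.
Qed.

Lemma poly_actB f g a : poly_act t (f - g) a = poly_act t f a - poly_act t g a.
Proof. by rewrite -scaleN1r poly_actDl poly_actZ mulrN1z. Qed.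

Lemma poly_actX a : poly_act t 'X a = t a.
Proof. by rewrite -[in LHS](mulr1 'X) poly_actXM poly_act1. Qed.

Lemma poly_actXn n a : poly_act t 'X^n a = iter n t a.
Proof.
elim: n => [|n IHn]; first by rewrite expr0 poly_act1.
by rewrite exprS poly_actXM IHn.
Qed.

Lemma poly_actr0 f : poly_act t f 0 = 0.
Proof.
by rewrite -[in LHS](poly_act0 0) -poly_actM mulr0 poly_act0.
Qed.

End PolyAct.

(* [s] lies in every nonzero Z[t, t^-1]-submodule. Applied to the submodule
   generated by [s - t s], this gives [q] in [X^j + (1 - X) Z[X]] that kills
   [s]. By noetherianity some [q^N a] generates a submodule meeting the kernel
   of [q] trivially, hence not containing [s]: so [q^N a = 0], and
   [q^N = X^(jN)] modulo [1 - X]. *)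
Lemma sub_id_surjective (A : zmodType) (t : {additive A -> A}) (t' : A -> A)
    (s : A) :
  cancel t t' -> cancel t' t -> injective (fun a => a - t a) -> s <> 0 ->
  (forall x, x <> 0 -> exists j f, iter j t s = poly_act t f x) ->
  forall a, exists b, b - t b = a.
Proof.
move=> tK t'K p_inj s0 s_min a.
have iter_inj n : injective (iter n t).
  by elim: n => // n IHn x y /= /(can_inj tK)/IHn.
have actp b : poly_act t (1 - 'X) b = b - t b.
  by rewrite poly_actB poly_act1 poly_actX.
have ps0 : s - t s <> 0.
  by move=> ps; apply: s0; apply: p_inj; rewrite /= ps raddf0 subr0.
have [j [r jr]] := s_min _ ps0.
pose q : {poly int} := 'X^j - r * (1 - 'X).
have qs : poly_act t q s = 0.
  by rewrite poly_actB poly_actXn jr poly_actM actp subrr.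
pose J k f := poly_act t (f * q ^+ k) a = 0.
have iJ k : is_ideal (J k).
  split; rewrite /J.
  - by rewrite mul0r poly_act0.
  - by move=> f g Jf Jg; rewrite mulrDl poly_actDl Jf Jg addr0.
  - by move=> g f Jf; rewrite -mulrA poly_actM Jf poly_actr0.
have [k f Jf|N HN] := poly_noetherian int_noetherian iJ.
  by rewrite /J exprS mulrCA poly_actM Jf poly_actr0.
have qNa : poly_act t (q ^+ N) a = 0.
  apply: contrapT => /s_min[i [f if_]].
  have /HN : J N.+1 f.
    rewrite /J exprS mulrCA poly_actM poly_actM -if_ -poly_actXn -poly_actM.
    by rewrite mulrC poly_actM qs poly_actr0.
  rewrite /J poly_actM -if_ => is0; apply: s0; apply: (@iter_inj i).
  by rewrite is0; elim: i {if_ is0} => //= i <-; rewrite raddf0.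
have [b pb] : exists b, b - t b = iter (j * N) t a.
  (* The witness comes from factoring [X^(jN) - q^N] by [X^j - q = r (1 - X)]. *)
  exists (poly_act t (r * \sum_(i < N) ('X^j) ^+ (N.-1 - i) * q ^+ i) a).
  have Xj_q : 'X^j - q = r * (1 - 'X) by rewrite subKr.
  rewrite -actp -poly_actM mulrA (mulrC (1 - 'X)) -Xj_q -subrXX poly_actB qNa.
  by rewrite subr0 -exprM poly_actXn.
(* [1 - t] commutes with [t'], so the powers of [t] are stripped off one by one. *)
elim: (j * N)%N b pb => [|n IHn] b pb; first by exists b.
apply: (IHn (t' b)); apply: (can_inj tK).
by rewrite raddfB !t'K pb.
Qed.

(** * The displacement group *)

Section Displacements.
Variables (Q : quandleType) (medQ : medial Q).
Implicit Types (x y z u v : Q) (g h : Q -> Q).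

Lemma qmul_qldivr x y z :
  qmul x (qldiv y z) = qldiv (qmul x y) (qmul x z).
Proof. by have [_ _ <-] := medQ; rewrite qldivxx. Qed.

Lemma qldiv_qmulr x y z :
  qldiv x (qmul y z) = qmul (qldiv x y) (qldiv x z).
Proof. by have [_ _ ->] := medQ; rewrite qmulxx. Qed.

Lemma qldiv_qldivr x y z :
  qldiv x (qldiv y z) = qldiv (qldiv x y) (qldiv x z).
Proof. by have [_ <- _] := medQ; rewrite qldivxx. Qed.

(** Closed under inverses, because L_y L_x^-1 is the inverse of L_x L_y^-1. *)
Inductive displacement : (Q -> Q) -> Prop :=
| disp_id : displacement id
| disp_cons x y g :
    displacement g -> displacement (fun z => qmul x (qldiv y (g z))).

Lemma eq_disp g h : g =1 h -> displacement g -> displacement h.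
Proof. by move=> /funext ->. Qed.

(** Distributivity makes the left translation by [qmul x y] equal to L_x L_y L_x^-1; substitute this
    in mediality and cancel L_x. Commutation of displacements rests on this. *)
Lemma qmul_swap x y u z :
  qmul y (qldiv x (qmul u z)) = qmul u (qldiv x (qmul y z)).
Proof.
have conj a b : qmul (qmul x a) b = qmul x (qmul a (qldiv x b)).
  by rewrite qmulDr qldivK.
have [/(_ x y u z) + _ _] := medQ.
by rewrite !conj => /(can_inj (qmulK x)).
Qed.

Lemma qldiv_swap x y u z :
  qldiv u (qmul x (qldiv y z)) = qldiv y (qmul x (qldiv u z)).
Proof.
apply: (can_inj (qmulK u)); rewrite qldivK.
apply: (can_inj (qldivK x)); rewrite qmulK.
apply: (can_inj (qmulK y)); rewrite qldivK.
by rewrite qmul_swap qldivK qmulK qldivK.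
Qed.

Lemma disp_comm_gen g x y z : displacement g ->
  g (qmul x (qldiv y z)) = qmul x (qldiv y (g z)).
Proof.
elim=> {g} // u v g _ ->.
by rewrite qldiv_swap qmul_swap.
Qed.

Lemma disp_comm g h z : displacement g -> displacement h -> g (h z) = h (g z).
Proof. by move=> dg; elim=> {h} // x y h _ IHh; rewrite disp_comm_gen// IHh. Qed.

Lemma disp_comp g h :
  displacement g -> displacement h -> displacement (fun z => g (h z)).
Proof. by move=> + dh; elim=> {g} // x y g _; apply: disp_cons. Qed.

Lemma disp_inv g : displacement g ->
  exists h, displacement h /\ forall z, h (g z) = z.
Proof.
elim=> {g} [|x y g _ [h [dh hK]]]; first by exists id; split=> //; apply: disp_id.
exists (fun z => h (qmul y (qldiv x z))); split.
  by apply: (disp_comp dh (disp_cons y x disp_id)).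
by move=> z; rewrite qmulK qldivK hK.
Qed.

Lemma disp_qmul g x y : displacement g -> g (qmul x y) = qmul (g x) (g y).
Proof. by elim=> {g} // u v g _ ->; rewrite qldiv_qmulr qmulDr. Qed.

Lemma disp_qldiv g x y : displacement g -> g (qldiv x y) = qldiv (g x) (g y).
Proof. by elim=> {g} // u v g _ ->; rewrite qldiv_qldivr qmul_qldivr. Qed.

Lemma disp_conj x g :
  displacement g -> displacement (fun z => qmul x (g (qldiv x z))).
Proof.
elim=> {g} [|u v g _ IHg]; first by apply: (disp_cons x x disp_id).
apply: eq_disp (disp_cons (qmul x u) (qmul x v) IHg) => z.
by rewrite -qmul_qldivr -qmulDr.
Qed.

Lemma disp_conjV x g :
  displacement g -> displacement (fun z => qldiv x (g (qmul x z))).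
Proof.
elim=> {g} [|u v g _ IHg].
  by apply: eq_disp disp_id => z; rewrite qmulK.
apply: eq_disp (disp_cons (qldiv x u) (qldiv x v) IHg) => z.
by rewrite -qldiv_qldivr -qldiv_qmulr.
Qed.

Lemma disp_conjV_indep x y g z : displacement g ->
  qldiv x (g (qmul x z)) = qldiv y (g (qmul y z)).
Proof.
move=> dg; apply: (can_inj (qmulK x)).
by rewrite qldivK -disp_comm_gen// qmulK.
Qed.

(** L_y^-1 L_x is itself a displacement, namely L_w L_y^-1 with [w = qldiv y x], so it commutes with
    [g]. *)
Lemma disp_conj_indep x y g z : displacement g ->
  qmul x (g (qldiv x z)) = qmul y (g (qldiv y z)).
Proof.
move=> dg; rewrite -[z in LHS](qldivK y); set w := qldiv y z.
apply: (can_inj (qldivK y)); rewrite qmulK qldiv_qmulr.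
by rewrite -disp_comm_gen// -qldiv_qmulr qldivK qmulK.
Qed.

(* The unused argument lets unification find the group structure, which
   depends on mediality. *)
Definition disp_group of medial Q : Type := {g : Q -> Q | displacement g}.
Local Notation D := (disp_group medQ).

Implicit Types (n m k : D).

Lemma disp_group_eqP n m : (forall z, sval n z = sval m z) -> n = m.
Proof.
case: n m => [g dg] [h dh] /= /funext gh; subst h.
by rewrite (Prop_irrelevance dg dh).
Qed.

Definition disp_add n m : D :=
  exist _ _ (disp_comp (svalP n) (svalP m)).
Definition disp_zero : D := exist _ _ disp_id.
Definition disp_opp n : D :=
  exist _ _ (proj1 (svalP (cid (disp_inv (svalP n))))).

Lemma disp_addA : associative disp_add.
Proof. by move=> n m k; apply: disp_group_eqP. Qed.

Lemma disp_addC : commutative disp_add.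
Proof. by move=> n m; apply: disp_group_eqP => z; exact: disp_comm (svalP n) (svalP m). Qed.

Lemma disp_add0 : left_id disp_zero disp_add.
Proof. by move=> n; apply: disp_group_eqP. Qed.

Lemma disp_addN : left_inverse disp_zero disp_opp disp_add.
Proof.
move=> n; apply: disp_group_eqP => z /=.
by case: cid => h [_ hK] /=.
Qed.

HB.instance Definition _ := gen_eqMixin D.
HB.instance Definition _ := gen_choiceMixin D.
HB.instance Definition _ :=
  GRing.isZmodule.Build D disp_addA disp_addC disp_add0 disp_addN.

Variable o : Q.

Definition conj_disp n : D := exist _ _ (disp_conj o (svalP n)).
Definition conjV_disp n : D := exist _ _ (disp_conjV o (svalP n)).

Lemma conj_disp_nmod_morphism : nmod_morphism conj_disp.
Proof.
split=> [|n m]; apply: disp_group_eqP => z /=; first exact: qldivK.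
by rewrite qmulK.
Qed.

HB.instance Definition _ :=
  GRing.isNmodMorphism.Build D D conj_disp
    conj_disp_nmod_morphism.

Lemma conj_dispK : cancel conj_disp conjV_disp.
Proof. by move=> n; apply: disp_group_eqP => z /=; rewrite !qmulK. Qed.

Lemma conjV_dispK : cancel conjV_disp conj_disp.
Proof. by move=> n; apply: disp_group_eqP => z /=; rewrite !qldivK. Qed.

End Displacements.

(** * Injectivity of right translations *)

(** Writing [e] as [qmul e e] or [qldiv e e], mediality makes R_e an endomorphism; this is its
    kernel. *)
Lemma ker_right_translation_congruence (Q : quandleType) (e : Q) :
  medial Q -> congruence (fun x y => qmul x e = qmul y e).
Proof.
move=> [mm _ md]; split=> //.
- by move=> x y z -> ->.
- by move=> x x' y y' xx yy; rewrite -{1 2}(qmulxx e) mm xx yy -mm.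
- by move=> x x' y y' xx yy; rewrite -{1 2}(qldivxx e) md xx yy -md.
Qed.

(** The coordinate [i] is the rightmost variable of a term for [f]. *)
Lemma term_fixed (Q : quandleType) (x : Q) n (f : n.-tuple Q -> Q) :
  (forall y, qmul y x = x) -> term_operation f ->
  exists i, forall a, tnth a i = x -> f a = x.
Proof.
move=> fx; elim=> {n f} [n f [] | n i | m n f g _ [i fi] _ IHg].
- by exists (Ordinal (isT : (1 < 2)%N)) => a ax; rewrite /op2 ax fx.
- exists (Ordinal (isT : (1 < 2)%N)) => a ax; rewrite /op2 ax.
  by apply: (can_inj (qmulK (tnth a (Ordinal (isT : (0 < 2)%N))))); rewrite qldivK fx.
- by exists i.
- have [j gj] := IHg i; exists j => a ax.
  by apply: fi; rewrite tnth_mktuple gj.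
Qed.

(** Among three arguments from a pair two coincide and cancel, so every pair is closed under x + y +
    z. *)
Lemma sum3_clone_pair (Q : Type) (add : Q -> Q -> Q) (zero : Q) (u v : Q)
    n (f : n.-tuple Q -> Q) :
  associative add -> commutative add -> left_id zero add ->
  self_inverse zero add ->
  clone (single_op3 (fun x y z => add (add x y) z)) f ->
  forall a, (forall i, tnth a i = u \/ tnth a i = v) -> f a = u \/ f a = v.
Proof.
move=> addA addC add0 addN; elim=> {n f} [n f [] | n i | m n f g _ IHf _ IHg] a uv.
- rewrite /op3; have addr0 x : add x zero = x by rewrite addC add0.
  have addK x y : add (add x y) y = x by rewrite -addA addN addr0.
  have addKr x y : add (add x y) x = y by rewrite (addC x) addK.
  case: (uv (Ordinal (isT : (0 < 3)%N))) => ->;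
    case: (uv (Ordinal (isT : (1 < 3)%N))) => ->;
    case: (uv (Ordinal (isT : (2 < 3)%N))) => ->;
    by rewrite ?addN ?add0 ?addK ?addKr; auto.
- exact: uv.
- by apply: IHf => i; rewrite tnth_mktuple; apply: IHg.
Qed.

(** The product is [x] or [y]; if it is [x], which is also [qmul x x], left cancellation gives
    [y = x]. *)
Lemma sum3_right_projection (Q : quandleType) :
  generated_by_sum3_mod2 Q -> forall x y : Q, qmul x y = y.
Proof.
move=> [add [zero [addA addC add0 addN termP]]] x y.
have /termP/(sum3_clone_pair (u := x) (v := y)) : term_operation (op2 (@qmul Q)).
  by apply: clone_gen; apply: basic_mul.
move=> /(_ zero addA addC add0 addN [tuple x; y]) [||//].
- by case; case=> [|[|//]] /= ?; [left | right].
- rewrite /op2 !(tnth_nth x) /= => xy.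
  by rewrite xy; apply: (can_inj (qmulK x)); rewrite qmulxx xy.
Qed.

(* If [x] were fixed by all left translations, every binary term would be
   constant in one of its variables once the other one is set to [x]. *)
Lemma quasi_affine_no_fixed (Q : quandleType) (x : Q) :
  has_cancellative_binary_term Q \/ generated_by_sum3_mod2 Q ->
  (forall y, qmul y x = x) -> forall y, y = x.
Proof.
move=> qa fx y; case: qa => [[b [tb bI Ib]]|sum3].
  have [[[|[|//]] i2] bx] := term_fixed fx tb.
    apply: (bI x); have b0 z : b x z = x.
      have := bx [tuple x; z]; rewrite /op2 !(tnth_nth x) /=; exact.
    by rewrite !b0.
  apply: (Ib x); have b0 z : b z x = x.
    have := bx [tuple z; x]; rewrite /op2 !(tnth_nth x) /=; exact.
  by rewrite !b0.
have proj := sum3_right_projection sum3.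
have [add [zero [addA addC add0 addN termP]]] := sum3.
suff zP z : z = zero by rewrite (zP y) (zP x).
have /termP t3 : clone (single_op3 (fun x y z => add (add x y) z))
    (op3 (fun x y z => add (add x y) z)).
  by apply: clone_gen; apply: single_op3_intro.
have addr0 w : add w zero = w by rewrite addC add0.
(* As products are right projections, [zero] is fixed, so [zero] in one suitable variable of x + y +
   z forces the value [zero]; with [z] in another variable the value is [z]. *)
have [[[|[|[|//]]] i3] fi] := term_fixed (proj^~ zero) t3.
- have := fi [tuple zero; z; zero]; rewrite /op3 !(tnth_nth zero) /=.
  by rewrite add0 addr0; exact.
- have := fi [tuple z; zero; zero]; rewrite /op3 !(tnth_nth zero) /=.
  by rewrite !addr0; exact.
- have := fi [tuple z; zero; zero]; rewrite /op3 !(tnth_nth zero) /=.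
  by rewrite !addr0; exact.
Qed.

Lemma monolith_neq (Q : quandleType) : subdirectly_irreducible Q ->
  exists u v : Q, monolith u v /\ v <> u.
Proof.
move=> [_ ntQ]; apply: contrapT => nuv; apply: ntQ => x y; split=> [xy|->].
  by apply: contrapT => x_y; apply: nuv; exists x, y; split=> // /esym.
exact: (cong_refl (monolith_congruence Q)).
Qed.

Lemma monolith_block_fixed (Q : quandleType) (qaQ : quasi_affine_type Q)
    (x : Q) :
  (forall y, monolith x y -> qmul y x = x) -> forall y, monolith x y -> y = x.
Proof.
move=> fx y xy; pose ct := monolith_congruence Q.
pose b_x : block ct x := exist _ x (cong_refl ct x).
pose b_y : block ct x := exist _ y xy.
suff : b_y = b_x by move=> /(congr1 sval).
apply: quasi_affine_no_fixed (qaQ x) _ _ => -[z xz].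
by apply: block_inj; apply: fx.
Qed.

Lemma right_translation_inj (Q : quandleType) :
  subdirectly_irreducible Q -> medial Q -> quasi_affine_type Q ->
  forall e : Q, injective (fun x => qmul x e).
Proof.
move=> /monolith_neq[u [v [uv v_u]]] medQ qaQ.
have ker_ge (e : Q) : ~ injective (fun x => qmul x e) ->
    forall x y, monolith x y -> qmul x e = qmul y e.
  move=> ninj x y xy; apply: (xy (fun a b => qmul a e = qmul b e)).
  split; first exact: (ker_right_translation_congruence e medQ).
  by move=> eqP_; apply: ninj => a b /eqP_.
have block_inj (x y : Q) : monolith x y -> y <> x -> injective (fun z => qmul z x).
  move=> xy yx; apply: contrapT => /ker_ge kx; apply: yx.
  apply: (monolith_block_fixed qaQ _ xy) => z xz.
  by rewrite -(kx _ _ xz) qmulxx.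
move=> e; apply: contrapT => /ker_ge ke; apply: (v_u).
have ct := monolith_congruence Q.
(* R_u and the right translation by [qmul e u] are injective, since both points lie in nontrivial
   blocks. Mediality turns (v u)(e u) into (v e)(u u), where [v] may be replaced by [u]. *)
apply: (block_inj _ _ uv v_u); apply: (block_inj (qmul e u) (qmul e v)).
- by apply: (cong_mul ct) => //; apply: (cong_refl ct).
- by move=> /(can_inj (qmulK e)).
- by have [mm _ _] := medQ; rewrite /= (mm v u) (mm u u) (ke _ _ uv).
Qed.

(** * Surjectivity of right translations *)

Section OrbitCongruences.
Variables (Q : quandleType) (medQ : medial Q) (e : Q).
Local Notation D := (disp_group medQ).
Local Notation t := (conj_disp (medQ := medQ) e).
Local Notation t' := (conjV_disp (medQ := medQ) e).

Record disp_submodule (N : D -> Prop) : Prop := DispSubmodule {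
  dsub0 : N 0;
  dsubB : forall n m, N n -> N m -> N (n - m);
  dsubT : forall n, N n -> N (t n);
  dsubV : forall n, N n -> N (t' n)
}.

Lemma disp_submodule_congruence (N : D -> Prop) : disp_submodule N ->
  congruence (fun x y => exists2 n, N n & y = sval n x).
Proof.
move=> [N0 NB NT NV].
have NN n : N n -> N (- n) by rewrite -(sub0r n); apply: NB.
have ND n m : N n -> N m -> N (n + m).
  by move=> Nn Nm; rewrite -(opprK m); apply: NB => //; apply: NN.
have NK (n : D) z : sval n (sval (- n) z) = z.
  by have /(congr1 (fun k : D => sval k z)) := subrr n.
have KN (n : D) z : sval (- n) (sval n z) = z.
  by have /(congr1 (fun k : D => sval k z)) := addNr n.
split.
- by move=> x; exists 0.
- by move=> x _ [n Nn ->]; exists (- n); [apply: NN | rewrite KN].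
- by move=> x _ _ [n Nn ->] [m Nm ->]; exists (m + n); [apply: ND|].
(* Pulling [n] out of (n x)(m y) leaves [- n + m] acting on [y]; moving it past L_x conjugates it,
   which applies [t]. *)
- move=> x _ y _ [n Nn ->] [m Nm ->]; exists (n + t (- n + m)).
    by apply: (ND) => //; apply: NT; apply: ND => //; apply: NN.
  transitivity (sval n (qmul e (sval (- n + m) (qldiv e (qmul x y))))) => //.
  rewrite (disp_conj_indep medQ e x _ (svalP _)) qmulK.
  rewrite (disp_qmul medQ _ _ (svalP n)).
  by rewrite (NK n (sval m y) : sval n (sval (- n + m) y) = _).
- move=> x _ y _ [n Nn ->] [m Nm ->]; exists (n + t' (- n + m)).
    by apply: (ND) => //; apply: NV; apply: ND => //; apply: NN.
  transitivity (sval n (qldiv e (sval (- n + m) (qmul e (qldiv x y))))) => //.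
  rewrite (disp_conjV_indep medQ e x _ (svalP _)) qldivK.
  rewrite (disp_qldiv medQ _ _ (svalP n)).
  by rewrite (NK n (sval m y) : sval n (sval (- n + m) y) = _).
Qed.

(** These are the values at [x] of Laurent polynomials in [t], with the denominator [t^j]
    cleared. *)
Lemma cyclic_disp_submodule (x : D) : disp_submodule
  (fun y => exists j f, iter j t y = poly_act t f x).
Proof.
have itB j (n m : D) : iter j t (n - m) = iter j t n - iter j t m.
  by elim: j => //= j ->; rewrite raddfB.
split.
- by exists 0%N, 0; rewrite poly_act0.
- move=> n m [j [f nf]] [i [g mg]]; exists (j + i)%N, ('X^i * f - 'X^j * g).
  rewrite itB poly_actB !poly_actM !poly_actXn -nf -mg.
  by rewrite -!iterD (addnC i).
- move=> n [j [f nf]]; exists j, ('X * f).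
  by rewrite -iterSr iterS nf poly_actXM.
- move=> n [j [f nf]]; exists j.+1, f.
  by rewrite iterSr conjV_dispK.
Qed.

Hypothesis inj_mul : forall y : Q, injective (fun x => qmul x y).

(** If [k] fixes [x], it fixes [qmul z x], the image of [x] under L_z L_x^-1, which commutes with
    [k]. Hence [k z] and [z] have the same image under R_x. *)
Lemma disp_semiregular (n m : D) x : sval n x = sval m x -> n = m.
Proof.
suff fix_id (k : D) : sval k x = x -> k = 0.
  move=> nm; apply/subr0_eq/fix_id.
  rewrite addrC /= nm.
  by have /(congr1 (fun k : D => sval k x)) := addNr m.
move=> kx; apply: disp_group_eqP => z; apply: (inj_mul (y := x)) => /=.
rewrite -{1}kx -(disp_qmul medQ); last exact: svalP.
rewrite -{1}(qldivxx x) (disp_comm_gen medQ); last exact: svalP.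
by rewrite kx qldivxx.
Qed.

Lemma sub_conj_dispE (n : D) : sval (n - t n) e = qmul (sval n e) e.
Proof.
rewrite -raddfN /= qldivxx (disp_qmul medQ); last exact: svalP.
by have /(congr1 (fun k : D => sval k e)) /= -> := subrr n.
Qed.

Lemma sub_conj_disp_inj : injective (fun n : D => n - t n).
Proof.
move=> n m /= nm; apply: (@disp_semiregular _ _ e); apply: (inj_mul (y := e)).
by rewrite -!sub_conj_dispE nm.
Qed.

Lemma orbit_qmul x y : exists n : D, qmul x y = sval n y.
Proof.
exists (exist _ _ (disp_cons x y (@disp_id Q))).
by rewrite /= qldivxx.
Qed.

Lemma si_sub_conj_disp_surj : subdirectly_irreducible Q ->
  forall n : D, exists m : D, m - t m = n.
Proof.
move=> /monolith_neq[u [v [uv v_u]]].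
have sub_min N n : disp_submodule N -> N n -> n <> 0 ->
    exists2 m, N m & v = sval m u.
  move=> subN Nn n0.
  apply: (uv (fun x y => exists2 m, N m & y = sval m x)).
  split; first exact: disp_submodule_congruence.
  move=> /(_ e (sval n e)) [+ _] => /(_ (ex_intro2 _ _ n Nn erefl)) ne.
  by apply: n0; apply: (@disp_semiregular n 0 e).
have [n0 n0_neq0] : exists n : D, n <> 0.
  have [n nv] := orbit_qmul u v; exists n => n0; apply: v_u.
  by apply: (inj_mul (y := v)); rewrite /= nv n0 qmulxx.
(* [s] carries [u] to [v]; by semiregularity it is the only such displacement, so it lies in every
   nonzero submodule. *)
have [|s _ su] := sub_min (fun=> True) n0 _ I n0_neq0; first by split.
apply: (@sub_id_surjective D t t' s).
- exact: conj_dispK.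
- exact: conjV_dispK.
- exact: sub_conj_disp_inj.
- by move=> s0; apply: v_u; rewrite su s0.
- move=> x x0.
  have [|m xm mu] := sub_min _ x (cyclic_disp_submodule x) _ x0.
    by exists 0%N, 1; rewrite poly_act1.
  by rewrite (@disp_semiregular s m u) -?su.
Qed.

End OrbitCongruences.

Theorem theorem4p5 (Q : quandleType) (siQ : subdirectly_irreducible Q)
  (medQ : medial Q) (qaQ : quasi_affine_type Q) : latin Q.
Proof.
move=> e; have inj_mul := right_translation_inj siQ medQ qaQ.
have surj := si_sub_conj_disp_surj (medQ := medQ) e inj_mul siQ.
have /choice[g gK] : forall y, exists x, qmul x e = y.
  (* Two preimages under [1 - t] are taken: the first gives [y = m e] after cancelling R_e, the
     second writes [m e] as [qmul (k e) e]. *)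
  move=> y; have [n yn] := orbit_qmul medQ y e.
  have [m mn] := surj n; have [k km] := surj m; exists (sval k e).
  rewrite -sub_conj_dispE km; apply: (inj_mul e) => /=.
  by rewrite -sub_conj_dispE mn yn.
exists g => // x; apply: (inj_mul e) => /=; exact: gK.
Qed.
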